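(* For each integer $n\ge 2$ let $m_n\in\{1,\dots,n-1\}$ and let $k_n\ge 0$ be an integer. Put $b_n=n-m_n$ and let $E_n$ be the number of elements of $[n]=\{1,\dots,n\}$ that belong to none of $k_n$ independent uniformly random $m_n$-element subsets of $[n]$. Assume that, as $n\to\infty$, $$\lambda_n=n\left(\frac{n-m_n}{n}\right)^{k_n}\longrightarrow\lambda\in(0,\infty),\qquad b_n=n-m_n\longrightarrow\infty .$$ Then $E_n$ converges in distribution to the Poisson law with mean $\lambda$. Equivalently, for every fixed integer $u\ge 0$, $$\mathbb{P}(E_n=u)\longrightarrow e^{-\lambda}\frac{\lambda^u}{u!}.$$
   Context: If $k_n=0$, the convention is $E_n=n$. Equivalently, $E_n=|B_1\cap\cdots\cap B_{k_n}|$ where $B_1,\dots,B_{k_n}$ are independent uniformly random $b_n$-element subsets of $[n]$ (the complements of the drawn subsets). *)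

(* Defs.v *)
From HB Require Import structures.
From mathcomp Require Import all_boot all_order all_algebra.
From mathcomp Require Import all_classical all_reals all_analysis.
Set Implicit Arguments.
Unset Strict Implicit.
Unset Printing Implicit Defensive.
Import Order.TTheory GRing.Theory Num.Theory.
Import numFieldNormedType.Exports.
Local Open Scope classical_set_scope.
Local Open Scope ring_scope.

HB.instance Definition _ (T : finType) :=
  isPointed.Build {set T} (@finset.set0 T).
HB.instance Definition _ (T : finType) :=
  @isMeasurable.Build default_measure_display {set T} discrete_measurable
    discrete_measurable0 discrete_measurableC discrete_measurableU.

Definition mutually_independent (R : realType) (d d' : measure_display)
    (T : measurableType d) (T' : measurableType d') (P : probability T R)
    (I : finType) (X : I -> {RV P >-> T'}) : Prop :=
  forall (J : {set I}) (B : I -> set T'), (forall i, measurable (B i)) ->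
    P (\bigcap_(i in [set` J]) (X i @^-1` B i)) =
    (\prod_(i in J) P (X i @^-1` B i))%E.

Arguments mutually_independent {R d d' T T'} P {I} X.

Definition uniform_subset (R : realType) (d : measure_display)
    (T : measurableType d) (P : probability T R) (n m : nat)
    (X : {RV P >-> {set 'I_n}}) : Prop :=
  forall A : {set 'I_n}, distribution P X [set A] =
    (if #|A| == m then ('C(n, m)%:R^-1)%:E else 0)%E.

Arguments uniform_subset {R d T} P {n} m X.

Section uncovered.
Context (d : measure_display) (T : measurableType d) (n k : nat).
Variable S : 'I_k -> {mfun T >-> {set 'I_n}}.

Definition uncovered (w : T) : nat :=
  #|[pred x : 'I_n | [forall i : 'I_k, x \notin S i w]]|.

Let measurable_uncovered : measurable_fun setT uncovered.
Proof.
pose F (A : {ffun 'I_k -> {set 'I_n}}) : nat :=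
  #|[pred x : 'I_n | [forall i : 'I_k, x \notin A i]]|.
move=> _ U _; rewrite setTI.
have -> : uncovered @^-1` U =
    \bigcup_(A in [set A | U (F A)]) \bigcap_(i in [set: 'I_k])
      (S i @^-1` [set A i]).
  have FE w (A : {ffun _}) : (forall i, S i w = A i) -> uncovered w = F A.
    move=> SA; apply: eq_card => x; rewrite !inE.
    by apply: eq_forallb => i; rewrite SA.
  apply/seteqP; split => w /=.
    move=> Uw; exists [ffun i => S i w]; last by move=> i _ /=; rewrite ffunE.
    by rewrite /= -(FE w)// => i; rewrite ffunE.
  by case=> A /= UA SA; rewrite (FE w A)// => i; apply: SA.
apply: fin_bigcup_measurable => [|A _]; first exact: finite_finset.
apply: fin_bigcap_measurable => [|i _]; first exact: finite_finset.
by rewrite -[X in measurable X]setTI; exact: measurable_funP.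
Qed.

HB.instance Definition _ :=
  isMeasurableFun.Build _ _ _ _ uncovered measurable_uncovered.

End uncovered.

Definition nat_to_real (R : realType) (u : nat) : R := u%:R.

Lemma measurable_nat_to_real (R : realType) : measurable_fun setT (@nat_to_real R).
Proof. by []. Qed.

HB.instance Definition _ (R : realType) :=
  isMeasurableFun.Build _ _ _ _ (@nat_to_real R) (@measurable_nat_to_real R).

(* The second argument of poisson_prob is a dummy: its body does not use it. *)
Definition poisson_law (R : realType) (lambda : R) : probability R R :=
  distribution (poisson_prob lambda 0) (@nat_to_real R).

(* The random variables may live on different probability spaces. *)
Definition cvg_in_distribution (R : realType) (d : nat -> measure_display)
    (T : forall n, measurableType (d n)) (P : forall n, probability (T n) R)
    (X : forall n, {RV (P n) >-> R}) (mu : probability R R) : Prop :=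
  forall x : R, {for x, continuous (fun y : R => mu `]-oo, y]%classic)} ->
    cdf (X n) x @[n --> \oo] --> mu `]-oo, x]%classic.

Arguments cvg_in_distribution {R d T} P X mu.

(* Main.v *)
Require Import Defs.
From mathcomp Require Import all_boot all_order all_algebra.
From mathcomp Require Import all_classical all_reals all_analysis.
From mathcomp Require Import ring lra.
Set Implicit Arguments.
Unset Strict Implicit.
Unset Printing Implicit Defensive.
Import Order.TTheory GRing.Theory Num.Theory.
Import numFieldNormedType.Exports.
Local Open Scope classical_set_scope.
Local Open Scope ring_scope.

(** The proof is the method of binomial moments.  A fixed r-element set avoids
one uniform m-subset of an n-set with probability 'C(n - r, m) / 'C(n, m), so
by independence the expectation of 'C(E, r) is
  M(r) = 'C(n, r) * ('C(n - r, m) / 'C(n, m)) ^ k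
(uncovered_binomial_moment).  Since E takes values in a finite range, inverting
the binomial transform recovers its law as a finite alternating sum,
  P(E = u) = sum_s (-1)^s 'C(u + s, u) M(u + s)      (prob_uncovered),
and what remains is to pass to the limit in this sum.

With b = n - m one has r! M(r) = prod_(j < r) (n - j) ((b - j) / (n - j)) ^ k
(subset_momentE).  Write p = b / n and L = n p ^ k, the quantity that converges
to lambda.  Every factor of the product is at most L, which dominates the
alternating sum by an exponential series.  Every factor also tends to lambda:
by Bernoulli's inequality its ratio to L is at least
(1 - j / n) (1 - 2 j k (1 - p) / b), so the point is that k (1 - p) = o(b).
This is where b -> oo enters.  For k > 0, L = b p ^ (k - 1), so that
exp (- (k - 1) (1 - p)) >= p ^ (k - 1) = L / b: hence (k - 1) (1 - p) is at most
log (b / L), and log b = o(b) (rounds_le, cvg_rounds).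

Hence M(r) -> lambda ^ r / r!, and Tannery's theorem (tannery) sends the
alternating sum to
  lambda ^ u / u! * sum_s (- lambda) ^ s / s! = exp (- lambda) lambda ^ u / u!.
For natural-number valued variables, pointwise convergence of the mass function
gives convergence in distribution, because a distribution function is then a
finite sum of masses (cvg_in_distribution_nat). *)

(** * Binomial inversion *)

Lemma ffact_addn n m r : (n ^_ (m + r) = n ^_ m * (n - m) ^_ r)%N.
Proof.
elim: m n => [|m IHm] n; first by rewrite ffactn0 mul1n subn0.
by rewrite addSn !ffactnS IHm mulnA -subn1 -subnDA add1n.
Qed.

(** After multiplication by m! both sides count the sequences of m + r distinct
elements: the r entries are chosen first on the left, last on the right. *)
Lemma bin_sub_ffact n m r : ('C(n - r, m) * n ^_ r = 'C(n, m) * (n - m) ^_ r)%N.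
Proof.
apply/eqP; rewrite -(eqn_pmul2l (fact_gt0 m)) !mulnA ![(m`! * _)%N]mulnC.
by rewrite !bin_ffact [X in X == _]mulnC -!ffact_addn addnC.
Qed.

(** Both sides count the pairs of disjoint sets of sizes u and s in a set of
size v. *)
Lemma bin_trinomial v u s :
  ('C(v, u + s) * 'C(u + s, u) = 'C(v, u) * 'C(v - u, s))%N.
Proof.
apply/eqP; rewrite -(@eqn_pmul2r (u`! * s`!)) ?muln_gt0 ?fact_gt0//.
have := bin_fact (leq_addr s u); rewrite addKn -mulnA => ->; rewrite bin_ffact.
by rewrite mulnACA !bin_ffact ffact_addn.
Qed.

(** The expansion of (1 - 1) ^ w, padded with vanishing terms up to N so that
the range of summation can be the same for all w. *)
Lemma alternating_bin_sum (R : comNzRingType) (w N : nat) : (w < N)%N ->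
  \sum_(s < N) (-1) ^+ s * 'C(w, s)%:R = (w == 0%N)%:R :> R.
Proof.
move=> wN; have -> : (w == 0%N)%:R = (1 - 1) ^+ w :> R by rewrite subrr expr0n.
rewrite exprBn.
rewrite (big_ord_widen_cond _ xpredT
  (fun i : nat => ((-1) ^+ i * 1 ^+ (w - i) * 1 ^+ i) *+ 'C(w, i) : R) wN).
rewrite [RHS]big_mkcond; apply: eq_bigr => s _ /=.
rewrite !expr1n !mulr1 mulr_natr; case: ifPn => //.
by rewrite -leqNgt => ws; rewrite bin_small// mulr0n.
Qed.

Lemma binomial_inversion (R : comNzRingType) (v u N : nat) : (v < N)%N ->
  \sum_(s < N) (-1) ^+ s * 'C(u + s, u)%:R * 'C(v, u + s)%:R = (v == u)%:R :> R.
Proof.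
move=> vN; transitivity
    ('C(v, u)%:R * \sum_(s < N) (-1) ^+ s * 'C(v - u, s)%:R : R).
  rewrite mulr_sumr; apply: eq_bigr => s _.
  by rewrite -mulrA -natrM [X in X%:R]mulnC bin_trinomial natrM mulrCA.
rewrite alternating_bin_sum; last by rewrite (leq_ltn_trans (leq_subr _ _)).
case: (ltngtP v u) => [vu|uv|->]; last by rewrite subnn binn mulr1.
  by rewrite bin_small// mul0r.
by rewrite subn_eq0 leqNgt uv mulr0.
Qed.

(** If q is the law of a random element i, the inner sum on the right is the
expectation of 'C(c i, u + s): the law of c is an alternating sum of its
binomial moments. *)
Lemma binomial_moment_inversion (R : comNzRingType) (I : finType) (q : I -> R)
    (c : I -> nat) (N u : nat) : (forall i, c i < N)%N ->
  \sum_(i | c i == u) q i = \sum_(s < N) (-1) ^+ s * 'C(u + s, u)%:R *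
    \sum_i q i * 'C(c i, u + s)%:R.
Proof.
move=> cN; under [RHS]eq_bigr do rewrite mulr_sumr.
rewrite exchange_big big_mkcond; apply: eq_bigr => i _ /=.
under eq_bigr do rewrite mulrCA.
rewrite -mulr_sumr binomial_inversion//.
by case: ifP => _; rewrite ?mulr1 ?mulr0.
Qed.

(** * The law of the number of uncovered points *)

Section prob.
Context (R : realType) (d : measure_display) (T : measurableType d).
Variable P : probability T R.

Lemma prob_mem_seq (I : eqType) (f : T -> I) (s : seq I) : uniq s ->
  (forall i, measurable (f @^-1` [set i])) ->
  P [set w | f w \in s] = (\sum_(i <- s) P (f @^-1` [set i]))%E.
Proof.
move=> + mf; have mem_cons x t : [set w | f w \in x :: t] =
    f @^-1` [set x] `|` [set w | f w \in t].
  apply/seteqP; split => w /=; rewrite inE.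
    by case/predU1P; [left|right].
  by case=> [->|->]; rewrite ?eqxx ?orbT.
have meas (t : seq I) : measurable [set w | f w \in t].
  elim: t => [|x t IHt]; last by rewrite mem_cons; exact: measurableU.
  by rewrite [X in measurable X](_ : _ = set0)//; apply/seteqP; split.
elim: s => [_|x s IHs /= /andP[xs us]].
  by rewrite big_nil -(measure0 P); congr (P _); apply/seteqP; split.
rewrite mem_cons measureU//; last first.
  by apply/seteqP; split=> w //= [-> ]; rewrite (negbTE xs).
by rewrite big_cons -IHs.
Qed.

Variables (n m : nat).

Lemma measurable_fun_discrete (X : {mfun T >-> {set 'I_n}}) B :
  measurable (X @^-1` B).
Proof. by rewrite -[X in measurable X]setTI; exact: measurable_funP. Qed.

Lemma uniform_subset_avoid (X : {RV P >-> {set 'I_n}}) (D : {set 'I_n}) :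
  uniform_subset P m X ->
  P (X @^-1` [set A : {set 'I_n} | A \subset ~: D]) =
  ('C(n - #|D|, m)%:R / 'C(n, m)%:R)%:E.
Proof.
move=> uX; have -> : X @^-1` [set A : {set 'I_n} | A \subset ~: D] =
    [set w | X w \in enum [pred A : {set 'I_n} | A \subset ~: D]].
  by apply/seteqP; split => w /=; rewrite mem_enum inE.
rewrite prob_mem_seq ?enum_uniq//; last by move=> A; exact: measurable_fun_discrete.
rewrite big_enum/=.
under eq_bigr => A _ do rewrite -[P _]/(distribution P X [set A]) uX.
rewrite -big_mkcondr sumEFin sumr_const [in RHS]mulrC -(mulr_natr _ #|_|).
congr EFin; congr (_ * _%:R).
have -> : (n - #|D| = #|~: D|)%N by rewrite [RHS]cardsCs finset.setCK card_ord.
by rewrite -cards_draws -[in RHS]cardsE; apply: eq_card => A; rewrite !inE.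
Qed.

(** Binomial moments are computed by counting the subsets of this random set, of
which uncovered is the cardinality. *)
Definition uncovered_set (k : nat) (S : 'I_k -> {mfun T >-> {set 'I_n}}) (w : T)
    : {set 'I_n} :=
  finset [pred x : 'I_n | [forall i : 'I_k, x \notin S i w]].

Section uncovered_set.
Variables (k : nat) (S : 'I_k -> {RV P >-> {set 'I_n}}).

Lemma sub_uncovered_set (D : {set 'I_n}) (w : T) :
  D \subset uncovered_set S w <-> forall i, S i w \subset ~: D.
Proof.
split => [/fintype.subsetP DU i|DS].
  apply/fintype.subsetP => x xS; rewrite inE; apply/negP => /DU.
  by rewrite inE => /forallP/(_ i); rewrite xS.
apply/fintype.subsetP => x xD; rewrite inE; apply/forallP => i.
by apply/negP => /(fintype.subsetP (DS i)); rewrite inE xD.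
Qed.

Lemma sub_uncovered_setE (D : {set 'I_n}) :
  [set w | D \subset uncovered_set S w] =
  \bigcap_(i in [set` [set: 'I_k]%SET]) (S i @^-1` [set A : {set 'I_n} | A \subset ~: D]).
Proof.
apply/seteqP; split => w /=.
  by move=> /sub_uncovered_set DS i _; exact: DS.
by move=> DS; apply/sub_uncovered_set => i; apply: DS; rewrite /= inE.
Qed.

Lemma measurable_uncovered_set (V : {set 'I_n}) :
  measurable (uncovered_set S @^-1` [set V]).
Proof.
have -> : uncovered_set S @^-1` [set V] =
    \bigcup_(A in [set A : {ffun 'I_k -> {set 'I_n}} |
                    V = finset [pred x : 'I_n | [forall i, x \notin A i]]])
      \bigcap_(i in [set: 'I_k]) (S i @^-1` [set A i]).
  apply/seteqP; split => w /=.
    move=> <-; exists [ffun i => S i w]; last by move=> i _ /=; rewrite ffunE.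
    by apply/setP => x; rewrite !inE; apply: eq_forallb => i; rewrite ffunE.
  case=> A /= -> SA; apply/setP => x; rewrite !inE.
  by apply: eq_forallb => i; rewrite SA.
apply: fin_bigcup_measurable => [|A _]; first exact: finite_finset.
apply: fin_bigcap_measurable => [|i _]; first exact: finite_finset.
exact: measurable_fun_discrete.
Qed.

Hypothesis uS : forall i, uniform_subset P m (S i).
Hypothesis iS : mutually_independent P S.

Lemma prob_sub_uncovered_set (D : {set 'I_n}) :
  P [set w | D \subset uncovered_set S w] =
  (('C(n - #|D|, m)%:R / 'C(n, m)%:R) ^+ k)%:E.
Proof.
rewrite sub_uncovered_setE iS//.
under eq_bigr => i _ do rewrite (uniform_subset_avoid _ (uS i)).
by rewrite prodEFin prodr_const finset.cardsT card_ord.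
Qed.

(** The expected number of r-sets left uncovered by k random m-subsets. *)
Definition subset_moment (r : nat) : R :=
  'C(n, r)%:R * ('C(n - r, m)%:R / 'C(n, m)%:R) ^+ k.

(** Double counting: 'C(#|V|, r) is the number of r-subsets D of V, and for each
of the 'C(n, r) sets D the probability that D is uncovered depends only on r. *)
Lemma uncovered_binomial_moment (r : nat) :
  \sum_V fine (P (uncovered_set S @^-1` [set V])) * 'C(#|V|, r)%:R =
  subset_moment r.
Proof.
pose q V := fine (P (uncovered_set S @^-1` [set V])).
rewrite -[LHS]/(\sum_V q V * 'C(#|V|, r)%:R).
have subD (D : {set 'I_n}) : \sum_(V : {set 'I_n} | D \subset V) q V =
    ('C(n - #|D|, m)%:R / 'C(n, m)%:R) ^+ k.
  apply: EFin_inj; rewrite -prob_sub_uncovered_set -sumEFin.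
  transitivity (P [set w | uncovered_set S w \in
      enum [pred V : {set 'I_n} | D \subset V]]); last first.
    by congr (P _); apply/seteqP; split => w /=; rewrite mem_enum inE.
  rewrite prob_mem_seq ?enum_uniq//; last exact: measurable_uncovered_set.
  rewrite big_enum/=; apply: eq_bigr => V _.
  by rewrite fineK// fin_num_measure//; exact: measurable_uncovered_set.
under eq_bigr => V _.
  rewrite -cards_draws -sum1_card natr_sum mulr_sumr.
  under eq_bigr do rewrite mulr1.
  under eq_bigl do rewrite inE andbC.
  rewrite big_mkcondr.
  over.
rewrite exchange_big/=; under eq_bigr => D Dr do rewrite -big_mkcond subD (eqP Dr).
rewrite sumr_const -(mulr_natl _ #|_|); congr (_%:R * _).
rewrite -[in RHS](card_ord n) -cardsT -cards_draws -[LHS]cardsE.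
by apply: eq_card => D; rewrite !inE finset.subsetT.
Qed.

Lemma prob_uncovered (u : nat) :
  P [set w | uncovered S w = u] =
  (\sum_(s < n.+1) (-1) ^+ s * 'C(u + s, u)%:R * subset_moment (u + s))%:E.
Proof.
under eq_bigr do rewrite -uncovered_binomial_moment.
rewrite -binomial_moment_inversion; last first.
  by move=> V; rewrite ltnS -[leqRHS]card_ord max_card.
transitivity (P [set w | uncovered_set S w \in
    enum [pred V : {set 'I_n} | #|V| == u]]).
  congr (P _); apply/seteqP; split => w /=; rewrite mem_enum inE.
    by move=> <-; rewrite cardsE.
  by move/eqP => <-; rewrite cardsE.
rewrite prob_mem_seq ?enum_uniq//; last exact: measurable_uncovered_set.
rewrite big_enum/= -sumEFin; apply: eq_bigr => V _.
by rewrite fineK// fin_num_measure//; exact: measurable_uncovered_set.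
Qed.

End uncovered_set.
End prob.

(** * Bounds on the factors of the moments *)

(** With b the size of the complement of a draw: the mean number of further
uncovered points, given that j prescribed points are uncovered. *)
Definition moment_factor (R : realType) (n b k j : nat) : R :=
  (n - j)%:R * ((b - j)%:R / (n - j)%:R) ^+ k.

Lemma subset_momentE (R : realType) (n m k r : nat) : (m <= n)%N ->
  subset_moment R n m k r =
  (\prod_(j < r) moment_factor R n (n - m) k j) / r`!%:R.
Proof.
move=> mn; rewrite /moment_factor big_split/= prodrXl prodf_div.
rewrite -!natr_prod -!ffact_prod /subset_moment.
apply: (canRL (mulfK _)); first by rewrite pnatr_eq0 -lt0n fact_gt0.
rewrite mulrAC -natrM bin_ffact; have [nr|rn] := ltnP n r.
  (* both sides vanish, the product through its factor j = n *)
  by rewrite ffact_small// !mul0r.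
congr (_ * _ ^+ _); apply/eqP; rewrite eqr_div; last 2 first.
- by rewrite pnatr_eq0 -lt0n bin_gt0.
- by rewrite pnatr_eq0 -lt0n ffact_gt0.
by rewrite -!natrM bin_sub_ffact mulnC.
Qed.

Section moment_factor.
Context (R : realType).
Implicit Types (n b k j : nat).

Lemma moment_factor_ge0 n b k j : 0 <= moment_factor R n b k j.
Proof. by rewrite mulr_ge0// exprn_ge0// divr_ge0. Qed.

Lemma moment_factor_le n b k j : (b <= n)%N ->
  moment_factor R n b k j <= n%:R * (b%:R / n%:R) ^+ k.
Proof.
move=> bn; rewrite /moment_factor; have [nj|jn] := leqP n j.
  by rewrite (eqP nj) mul0r mulr_ge0// exprn_ge0// divr_ge0.
have n0 : (0 < n)%N by case: n jn {bn}.
apply: ler_pM => //; first by rewrite ler_nat leq_subr.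
apply: lerXn2r; rewrite ?nnegrE ?divr_ge0//.
rewrite ler_pdivrMr ?ltr0n ?subn_gt0// mulrAC ler_pdivlMr ?ltr0n//.
rewrite -!natrM ler_nat mulnBl mulnBr leq_sub2l//.
by rewrite mulnC leq_mul2l bn orbT.
Qed.

Lemma bernoulli_ineq (x : R) k : x <= 1 -> 1 - k%:R * x <= (1 - x) ^+ k.
Proof.
move=> x1; elim: k => [|k IHk]; first by rewrite mul0r subr0 expr0.
have x10 : 0 <= 1 - x by rewrite subr_ge0.
rewrite exprS; apply: (le_trans _ (ler_wpM2l x10 IHk)).
have := mulr_ge0 (ler0n R k) (sqr_ge0 x); rewrite -natr1; nra.
Qed.

(** Apply bernoulli_ineq to the identity
(b - j) / (n - j) = (b / n) (1 - j (n - b) / (b (n - j))),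
where n - j is bounded below by n / 2. *)
Lemma moment_factor_ge n b k j : (0 < b)%N -> (j.*2 <= b)%N -> (b <= n)%N ->
  n%:R * (b%:R / n%:R) ^+ k * (1 - j%:R / n%:R) *
    (1 - j.*2%:R * (k%:R * (1 - b%:R / n%:R) / b%:R))
  <= moment_factor R n b k j.
Proof.
move=> b0 jb bn; have n0 : (0 < n)%N := leq_trans b0 bn.
have jn : (j.*2 <= n)%N := leq_trans jb bn.
have jb' : (j <= b)%N by rewrite (leq_trans _ jb)// -addnn leq_addr.
have jn' : (j < n)%N.
  by case: j jn {jb jb'} => // j; apply: leq_trans; rewrite -addnn addnS ltnS leq_addr.
have rn : 0 < n%:R :> R by rewrite ltr0n.
have rb : 0 < b%:R :> R by rewrite ltr0n.
have rbn : b%:R <= n%:R :> R by rewrite ler_nat.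
have rjn : 0 < n%:R - j%:R :> R by rewrite subr_gt0 ltr_nat.
have rjb2 : j%:R * 2 <= b%:R :> R by rewrite -natrM ler_nat muln2.
pose x : R := j%:R * 2 * (1 - b%:R / n%:R) / b%:R.
have x1 : x <= 1.
  rewrite /x ler_pdivrMr// mul1r; apply: le_trans rjb2.
  by rewrite ler_piMr ?mulr_ge0// gerBl divr_ge0.
have base : b%:R / n%:R * (1 - x) <= (b - j)%:R / (n - j)%:R :> R.
  rewrite !natrB ?(ltnW jn')// ler_pdivlMr//.
  rewrite (_ : _ * _ = (b%:R * n%:R - j%:R * 2 * (n%:R - b%:R)) *
                       (n%:R - j%:R) / n%:R ^+ 2); last first.
    by rewrite /x; field; rewrite !gt_eqF.
  rewrite ler_pdivrMr ?exprn_gt0//.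
  suff : 0 <= j%:R * (n%:R - b%:R) * (n%:R - 2 * j%:R) :> R by lra.
  by rewrite !mulr_ge0// subr_ge0//; lra.
apply: (@le_trans _ _ ((n%:R - j%:R) * (b%:R / n%:R * (1 - x)) ^+ k)).
  rewrite [in leRHS]exprMn.
  rewrite (_ : n%:R * _ * (_ - _) = (n%:R - j%:R) * (b%:R / n%:R) ^+ k); last first.
    by rewrite mulrAC; congr (_ * _); field; rewrite gt_eqF.
  rewrite [leRHS]mulrA ler_wpM2l ?mulr_ge0 ?(ltW rjn)// ?exprn_ge0 ?divr_ge0//.
  rewrite (_ : j.*2%:R * _ = k%:R * x) ?bernoulli_ineq//.
  by rewrite -muln2 natrM /x; field; rewrite !gt_eqF.
rewrite -natrB ?(ltnW jn')// ler_wpM2l// lerXn2r// ?nnegrE ?divr_ge0//.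
by rewrite mulr_ge0 ?divr_ge0 ?subr_ge0.
Qed.

(** With p = b / n, y = (k - 1) (1 - p) and L = b p ^ (k - 1), the inequality
p <= exp (p - 1) gives exp y <= b / L.  Combined with y ^ 2 / 2 <= exp y this
bounds y by the square root of 2 b / L, a weaker form of y <= log (b / L) that
suffices for y = o(b). *)
Lemma rounds_le n b k (L : R) : (0 < b <= n)%N -> (0 < k)%N ->
  L = n%:R * (b%:R / n%:R) ^+ k ->
  k%:R * (1 - b%:R / n%:R) / b%:R <= b%:R^-1 + Num.sqrt (2 * L^-1 * b%:R^-1).
Proof.
case: k => // k /andP[b0 bn] _ L_def; have n0 : (0 < n)%N := leq_trans b0 bn.
have rn : 0 < n%:R :> R by rewrite ltr0n.
have rb : 0 < b%:R :> R by rewrite ltr0n.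
have rbn : b%:R <= n%:R :> R by rewrite ler_nat.
set p : R := b%:R / n%:R; have p0 : 0 < p by rewrite divr_gt0.
have p1 : p <= 1 by rewrite ler_pdivrMr// mul1r.
pose y : R := k%:R * (1 - p); have y0 : 0 <= y by rewrite mulr_ge0 ?subr_ge0.
have LE : L = b%:R * p ^+ k by rewrite L_def exprS mulrA -/p /p mulrCA divff ?gt_eqF// mulr1.
have pk0 : 0 < p ^+ k by rewrite exprn_gt0.
have pk : p ^+ k <= expR (- y).
  rewrite (_ : - y = k%:R * (p - 1)) ?expRM_natl; last by rewrite /y; ring.
  rewrite lerXn2r ?nnegrE ?expR_ge0 ?(ltW p0)//.
  by rewrite (le_trans _ (expR_ge1Dx _))// addrC subrK.
have y2 : y ^+ 2 <= 2 / p ^+ k.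
  have ey : 1 + y ^+ 2 / 2 <= expR y := expR_ge1Dxn 1 y0.
  rewrite ler_pdivlMr//; apply: (@le_trans _ _ (y ^+ 2 * expR (- y))).
    by rewrite ler_wpM2l ?sqr_ge0.
  by rewrite expRN ler_pdivrMr ?expR_gt0//; lra.
have -> : k.+1%:R * (1 - p) / b%:R = (1 - p) / b%:R + y / b%:R.
  by rewrite -mulrDl -natr1 /y; ring.
apply: lerD; first by rewrite -[leRHS]mul1r ler_wpM2r ?invr_ge0// gerBl ltW.
rewrite -[leLHS]ger0_norm ?divr_ge0// -sqrtr_sqr ler_wsqrtr// LE.
rewrite exprMn exprVn [leRHS](_ : _ = 2 / p ^+ k * b%:R ^- 2); last first.
  by move: (p ^+ k) pk0 => q q0; field; rewrite !gt_eqF.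
by rewrite ler_wpM2r// invr_ge0 exprn_ge0.
Qed.

End moment_factor.

(** * Passage to the limit *)

Section limits.
Context (R : realType).

(** Dominated convergence for series: split at an index K beyond which the
tails of both h and g are small; the tail of f is controlled by that of h. *)
Lemma tannery (f : nat -> nat -> R) (g h : nat -> R) (N : nat -> nat) (G : R) :
  (\forall n \near \oo, forall s, `|f n s| <= h s) ->
  (forall s, f n s @[n --> \oo] --> g s) ->
  cvgn (series h) -> series g n @[n --> \oo] --> G -> N n @[n --> \oo] --> \oo ->
  \sum_(s < N n) f n s @[n --> \oo] --> G.
Proof.
move=> fh fg /cvg_ex[H hH] gG NN.
apply/cvgrPdist_le => e e0; have e4 : 0 < e / 4 by rewrite divr_gt0.
have /cvgrPdist_le/(_ _ e4)[K0 _ K0P] := hH.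
have /cvgrPdist_le/(_ _ e4)[K1 _ K1P] := gG.
pose K := maxn K0 K1.
have fgK : (series (f n) K @[n --> \oo] --> series g K).
  by rewrite /series/=; apply: cvg_big => //; exact: add_continuous.
near=> n.
have KN : (K <= N n)%N by near: n; move/cvgnyPge : NN; exact.
have hn : forall s, `|f n s| <= h s by near: n.
have fgn : `|series g K - series (f n) K| <= e / 4.
  by near: n; move/cvgrPdist_le : fgK; exact.
have gK : `|G - series g K| <= e / 4 by apply: K1P => /=; exact: leq_maxr.
have hK : `|H - series h K| <= e / 4 by apply: K0P => /=; exact: leq_maxl.
have hN : `|H - series h (N n)| <= e / 4.
  by apply: K0P => /=; apply: leq_trans KN; exact: leq_maxl.
have tail : `|series (f n) (N n) - series (f n) K| <= series h (N n) - series h K.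
  rewrite !sub_series_geq// (le_trans (ler_norm_sum _ _ _))//.
  by apply: ler_sum => s _; exact: hn.
rewrite -(big_mkord xpredT (f n)) -[X in G - X]/(series (f n) (N n)).
move: fgn gK hK hN tail; rewrite !ler_norml; lra.
Unshelve. all: by end_near. Qed.

Lemma cvg_inv_nat (b : nat -> nat) : b n @[n --> \oo] --> \oo ->
  ((b n)%:R^-1 : R) @[n --> \oo] --> (0 : R).
Proof.
move=> bo; apply/gtr0_cvgV0; last by apply/cvgrnyP.
by near=> n; rewrite ltr0n; near: n; move/cvgnyPge : bo; exact.
Unshelve. all: by end_near. Qed.

Section moment_limits.
Variables (b k : nat -> nat) (lambda : R).
Let L n : R := n%:R * ((b n)%:R / n%:R) ^+ k n.
Hypotheses (lambda0 : 0 < lambda) (Llambda : L n @[n --> \oo] --> lambda).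
Hypothesis bn : \forall n \near \oo, (b n <= n)%N.
Hypothesis bo : b n @[n --> \oo] --> \oo.

(** Without any draw L n would be n, which is unbounded. *)
Lemma rounds_gt0 : \forall n \near \oo, (0 < k n)%N.
Proof.
near=> n; rewrite lt0n; apply/eqP => k0.
have : L n <= lambda + 1 by near: n; apply: (cvgr_le _ Llambda); rewrite ltrDl.
have : lambda + 2 <= n%:R by near: n; exact: nbhs_infty_ger.
rewrite /L k0 expr0 mulr1; lra.
Unshelve. all: by end_near. Qed.

Lemma cvg_rounds :
  (k n)%:R * (1 - (b n)%:R / n%:R) / (b n)%:R @[n --> \oo] --> (0 : R).
Proof.
apply: (@squeeze_cvgr _ _ _ _ (fun=> 0) (fun n : nat =>
    (b n)%:R^-1 + Num.sqrt (2 * (L n)^-1 * (b n)%:R^-1))).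
- near=> n.
  have b0 : (0 < b n)%N by near: n; move/cvgnyPge : bo; exact.
  have bnn : (b n <= n)%N by near: n.
  apply/andP; split; last first.
    by apply: rounds_le; rewrite ?b0//; near: n; exact: rounds_gt0.
  rewrite !mulr_ge0 ?invr_ge0// subr_ge0 ler_pdivrMr ?mul1r ?ler_nat//.
  by rewrite ltr0n (leq_trans b0).
- exact: cvg_cst.
- rewrite -[X in _ --> X]addr0; apply: cvgD; first exact: cvg_inv_nat.
  have -> : 0 = Num.sqrt (2 * lambda^-1 * 0) :> R by rewrite mulr0 sqrtr0.
  apply: (continuous_cvg _ (@sqrt_continuous R _)).
  apply: cvgM; last exact: cvg_inv_nat.
  by apply: cvgM; [exact: cvg_cst|apply: cvgV => //; rewrite gt_eqF].
Unshelve. all: by end_near. Qed.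

Lemma cvg_moment_factor (j : nat) :
  moment_factor R n (b n) (k n) j @[n --> \oo] --> lambda.
Proof.
apply: (@squeeze_cvgr _ _ _ _ (fun n : nat => L n * (1 - j%:R * n%:R^-1) *
    (1 - j.*2%:R * ((k n)%:R * (1 - (b n)%:R / n%:R) / (b n)%:R))) L) => //.
- near=> n.
  have b0 : (0 < b n)%N by near: n; move/cvgnyPge : bo; exact.
  have bj : (j.*2 <= b n)%N by near: n; move/cvgnyPge : bo; exact.
  have bnn : (b n <= n)%N by near: n.
  by rewrite moment_factor_ge//= moment_factor_le.
- have -> : lambda = lambda * (1 - j%:R * 0) * (1 - j.*2%:R * 0).
    by rewrite !mulr0 subr0 !mulr1.
  apply: cvgM; first apply: cvgM => //.
    apply: cvgB; first exact: cvg_cst.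
    by apply: cvgM; [exact: cvg_cst|exact: cvg_inv_nat].
  apply: cvgB; first exact: cvg_cst.
  by apply: cvgM; [exact: cvg_cst|exact: cvg_rounds].
Unshelve. all: by end_near. Qed.

Let M n r : R := (\prod_(j < r) moment_factor R n (b n) (k n) j) / r`!%:R.

Lemma cvg_binomial_moment (r : nat) : M n r @[n --> \oo] --> lambda ^+ r / r`!%:R.
Proof.
apply: cvgM; last exact: cvg_cst.
rewrite -[in X in _ --> X](card_ord r) -prodr_const.
apply: cvg_big => [|j _]; first exact: mul_continuous.
exact: cvg_moment_factor.
Qed.

(** The domination needed by tannery is by the terms of the exponential series at
lambda + 1, an eventual bound of L n and hence of all the moment factors. *)
Lemma cvg_sieve (u : nat) :
  \sum_(s < n.+1) (-1) ^+ s * 'C(u + s, u)%:R * M n (u + s) @[n --> \oo] -->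
  expR (- lambda) * (lambda ^+ u / u`!%:R).
Proof.
(* the binomial coefficient splits the (u + s)-th exponential term into the u-th
   and the s-th ones *)
have binE (x : R) s : 'C(u + s, u)%:R * (x ^+ (u + s) / (u + s)`!%:R) =
    x ^+ u / u`!%:R * (x ^+ s / s`!%:R).
  have := bin_fact (leq_addr s u); rewrite addKn => <-.
  have c0 : 'C(u + s, u)%:R != 0 :> R by rewrite pnatr_eq0 -lt0n bin_gt0 leq_addr.
  have u0 : u`!%:R != 0 :> R by rewrite pnatr_eq0 -lt0n fact_gt0.
  have s0 : s`!%:R != 0 :> R by rewrite pnatr_eq0 -lt0n fact_gt0.
  by rewrite !natrM exprD; field; rewrite c0 u0 s0.
have cvg_exp (x y : R) : series (y *: exp_coeff x) n @[n --> \oo] --> expR x * y.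
  have -> : series (y *: exp_coeff x) = (fun n => series (exp_coeff x) n * y).
    by apply/funext => n; rewrite mulr_suml; apply: eq_bigr => i _; rewrite mulrC.
  by apply: cvgM; [exact: is_cvg_series_exp_coeff|exact: cvg_cst].
pose Lam := lambda + 1.
apply: (@tannery (fun n s => (-1) ^+ s * 'C(u + s, u)%:R * M n (u + s))
  (fun s => (-1) ^+ s * 'C(u + s, u)%:R *
    (lambda ^+ (u + s) / (u + s)`!%:R)) ((Lam ^+ u / u`!%:R) *: exp_coeff Lam) succn).
- near=> n => s.
  have bnn : (b n <= n)%N by near: n.
  have LLam : L n <= Lam by near: n; apply: (cvgr_le _ Llambda); rewrite ltrDl.
  have L0 : 0 <= L n by rewrite mulr_ge0// exprn_ge0// divr_ge0.
  rewrite -[leRHS]/(_ * (Lam ^+ s / s`!%:R)) -binE -mulrA normrM normrX normrN1 expr1n mul1r.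
  rewrite normrM normr_nat ler_wpM2l// normrM normfV normr_nat ler_wpM2r ?invr_ge0//.
  rewrite normr_prod -[in leRHS](card_ord (u + s)) -prodr_const.
  apply: ler_prod => j _; rewrite normr_ge0 ger0_norm ?moment_factor_ge0//=.
  exact: le_trans (moment_factor_le _ _ _ bnn) LLam.
- by move=> s; apply: cvgM; [exact: cvg_cst|exact: cvg_binomial_moment].
- by apply/cvg_ex; eexists; exact: cvg_exp.
- apply: cvg_trans (cvg_exp _ _); apply: near_eq_cvg; near=> n => /=.
  apply: eq_bigr => s _; rewrite -mulrA binE.
  by rewrite -[LHS]/(_ * (_ / _)) [in LHS]exprNn; ring.
- by apply/cvgnyPge => A; near=> n; rewrite ltnW// ltnS; near: n; exact: nbhs_infty_ge.
Unshelve. all: by end_near. Qed.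

End moment_limits.
End limits.

(** * From mass functions to convergence in distribution *)

(** For x < 0 the truncation of x is 0, and the filter removes that entry. *)
Definition nats_upto (R : realType) (x : R) : seq nat :=
  [seq u <- iota 0 (Num.truncn x).+1 | u%:R <= x].

Lemma mem_nats_upto (R : realType) (x : R) (u : nat) :
  (u \in nats_upto x) = (u%:R <= x).
Proof.
rewrite mem_filter mem_iota leq0n add0n ltnS/=; case: leP => //= ux.
by rewrite -(@natrK R u) le_truncn.
Qed.

Lemma prob_nat_le (R : realType) (d : measure_display) (T : measurableType d)
    (P : probability T R) (X : T -> nat) (x : R) :
  (forall u, measurable (X @^-1` [set u])) ->
  P ((@nat_to_real R \o X) @^-1` `]-oo, x]) =
  (\sum_(u <- nats_upto x) fine (P (X @^-1` [set u])))%:E.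
Proof.
move=> mX; rewrite -sumEFin.
under [RHS]eq_bigr do rewrite fineK ?fin_num_measure//.
rewrite -prob_mem_seq ?filter_uniq ?iota_uniq//; congr (P _).
by apply/seteqP; split => w /=; rewrite mem_nats_upto in_itv.
Qed.

(** On nat only finitely many values lie below a given x, so that convergence
holds at every x and not only at the continuity points of the limit law. *)
Lemma cvg_in_distribution_nat (R : realType) (d : nat -> measure_display)
    (T : forall n, measurableType (d n)) (P : forall n, probability (T n) R)
    (X : forall n, {RV (P n) >-> nat}) (Q : probability nat R) :
  (forall u : nat, P n (X n @^-1` [set u]) @[n --> \oo] --> Q [set u]) ->
  cvg_in_distribution P (fun n : nat => @nat_to_real R \o X n)
    (distribution Q (@nat_to_real R)).
Proof.
move=> XY x _; have mX n u : measurable (X n @^-1` [set u]).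
  by rewrite -[X in measurable X]setTI; exact: measurable_funP.
rewrite [X in _ --> X](_ : _ = (\sum_(u <- nats_upto x) fine (Q [set u]))%:E);
  last exact: (@prob_nat_le _ _ _ Q id).
under eq_cvg => n do rewrite [cdf _ _](prob_nat_le (P n) x (mX n)).
apply: cvg_EFin; first exact: nearW.
apply: cvg_big => [|u _]; first exact: add_continuous.
by apply: fine_cvg; rewrite fineK// fin_num_measure.
Qed.

Lemma poisson_prob1 (R : realType) (lambda : R) (u : nat) : 0 < lambda ->
  poisson_prob lambda 0 [set u] = (expR (- lambda) * (lambda ^+ u / u`!%:R))%:E.
Proof.
move=> l0; rewrite /poisson_prob l0 esum_set1 ?lee_fin ?poisson_pmf_ge0//.
by rewrite /poisson_pmf l0 mulrC.
Qed.

Theorem theorem1p1 (R : realType) (m k : nat -> nat)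
  (hm : forall n : nat, (2 <= n)%N -> (1 <= m n <= n.-1)%N)
  (d : nat -> measure_display) (Omega : forall n : nat, measurableType (d n))
  (P : forall n : nat, probability (Omega n) R)
  (S : forall n : nat, 'I_(k n) -> {RV (P n) >-> {set 'I_n}})
  (hunif : forall n : nat, (2 <= n)%N ->
     forall i : 'I_(k n), uniform_subset (P n) (m n) (S n i))
  (hindep : forall n : nat, (2 <= n)%N -> mutually_independent (P n) (S n))
  (lambda : R) (hlambda : 0 < lambda)
  (hcvg : n%:R * ((n - m n)%:R / n%:R) ^+ k n @[n --> \oo] --> lambda)
  (hb : (n - m n)%N @[n --> \oo] --> \oo) :
  let E (n : nat) : {RV (P n) >-> nat} := uncovered (S n) in
  cvg_in_distribution P (fun n : nat => @nat_to_real R \o E n) (poisson_law lambda) /\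
  (forall u : nat,
     P n [set w | E n w = u] @[n --> \oo] -->
     (expR (- lambda) * (lambda ^+ u / u`!%:R))%:E).
Proof.
move=> E.
have pmf u : P n [set w | E n w = u] @[n --> \oo] -->
    (expR (- lambda) * (lambda ^+ u / u`!%:R))%:E.
  pose p n : R := \sum_(s < n.+1) (-1) ^+ s * 'C(u + s, u)%:R *
    ((\prod_(j < u + s) moment_factor R n (n - m n) (k n) j) / (u + s)`!%:R).
  (* the laws of the draws are only prescribed for n >= 2 *)
  have Pp : \forall n \near \oo, P n [set w | E n w = u] = (p n)%:E.
    near=> n; have n2 : (2 <= n)%N by near: n; exact: nbhs_infty_ge.
    have mn : (m n <= n)%N.
      by have /andP[_ /leq_trans] := hm _ n2; apply; exact: leq_pred.
    rewrite (prob_uncovered (hunif _ n2) (hindep _ n2)); congr (_%:E).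
    by apply: eq_bigr => s _; rewrite subset_momentE.
  apply: cvg_EFin; first by near=> n; rewrite (near Pp n).
  have : p n @[n --> \oo] --> expR (- lambda) * (lambda ^+ u / u`!%:R).
    by apply: cvg_sieve => //; apply: nearW => n; exact: leq_subr.
  apply: cvg_trans; apply: near_eq_cvg; near=> n.
  by rewrite /= (near Pp n).
split => //.
apply: cvg_in_distribution_nat => u.
rewrite [X in _ --> X](poisson_prob1 u hlambda); exact: pmf.
Unshelve. all: by end_near. Qed.
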